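(* Let $X\subseteq[\mathbb{N}]^{\infty}$ be a $\mathfrak{p}$-generalized tower, so that $X\cup\mathrm{Fin}\subseteq P(\mathbb{N})$ is a $\mathfrak{p}$-generalized tower set, and equip $X\cup\mathrm{Fin}$ with the subspace topology inherited from the Michael line topology on $P(\mathbb{N})$. Then the space $X\cup\mathrm{Fin}$ satisfies $\binom{\Omega_{\mathrm{ctbl}}}{\Gamma}$; that is, every countable $\omega$-cover of $X\cup\mathrm{Fin}$ contains a subfamily that is a $\gamma$-cover of $X\cup\mathrm{Fin}$.
   Context: **Sets of natural numbers.** $P(\mathbb{N})$ is the power set of $\mathbb{N}$, $[\mathbb{N}]^{\infty}$ is the set of infinite subsets of $\mathbb{N}$, and $\mathrm{Fin}$ is the set of finite subsets of $\mathbb{N}$. Each $a\in[\mathbb{N}]^{\infty}$ is identified with its increasing enumeration, so $a(n)$ denotes the $n$-th element of $a$; for natural numbers $i<j$, $[i,j)=\{m\in\mathbb{N}: i\le m<j\}$. **The cardinal $\mathfrak{p}$.** For $a,b\in[\mathbb{N}]^{\infty}$ write $a\subseteq^* b$ if $a\setminus b$ is finite. A pseudointersection of a family of infinite subsets of $\mathbb{N}$ is an infinite set $a\subseteq\mathbb{N}$ with $a\subseteq^* b$ for all $b$ in the family. A family of infinite sets is centered if all finite intersections of its elements are infinite. $\mathfrak{p}$ is the minimal cardinality of a centered subfamily of $[\mathbb{N}]^{\infty}$ that has no pseudointersection. **Generalized towers.** Let $\kappa$ be an uncountable ordinal number (here $\kappa=\mathfrak{p}$). A set $X\subseteq[\mathbb{N}]^{\infty}$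 with $|X|\ge\kappa$ is a $\kappa$-generalized tower if for each $a\in[\mathbb{N}]^{\infty}$ there are $b\in[\mathbb{N}]^{\infty}$ and $S\subseteq X$ with $|S|<\kappa$ such that $$x\cap\bigcup_{n\in b}[a(n),a(n+1))\in\mathrm{Fin}\quad\text{for all } x\in X\setminus S.$$ A set $X\cup\mathrm{Fin}$ is a $\kappa$-generalized tower set if $X$ is a $\kappa$-generalized tower. **Michael line topology.** The Michael line is the set $P(\mathbb{N})$ with the topology in which the points of $[\mathbb{N}]^{\infty}$ are isolated and the neighborhoods of the points of $\mathrm{Fin}$ are those induced by the Cantor space topology on $P(\mathbb{N})$ (identifying $P(\mathbb{N})$ with $\{0,1\}^{\mathbb{N}}$ via characteristic functions). **Covers.** A cover of a space is a family of proper subsets of the space whose union is the whole space; it is open if all its members are open. An $\omega$-cover is an open cover such that each finite subset of the space is contained in a member of the cover. A $\gamma$-cover is an infinite open cover such that each point of the space belongs to all but finitely many members of the cover. $\Omega_{\mathrm{ctbl}}$ and $\Gamma$ denote the families of countable $\omega$-covers and of $\gamma$-covers of the space, respectively. For families $\mathcal{A},\mathcal{B}$ of covers of a space, $\binom{\mathcal{A}}{\mathcal{B}}$ is the property that every cover in $\mathcal{A}$ has a subcover (a subfamily of it) that belongs to $\mathcal{B}$. *)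

(* Defs.v *)
From HB Require Import structures.
From mathcomp Require Import all_boot.
From mathcomp Require Import all_classical.
From mathcomp Require Import topology cantor.

Set Implicit Arguments.
Unset Strict Implicit.
Unset Printing Implicit Defensive.

Local Open Scope classical_set_scope.
Local Open Scope card_scope.

Definition card_lt (T U : Type) (A : set T) (B : set U) : Prop :=
  A #<= B /\ ~ (B #<= A).

Definition Fin : set (set nat) := [set a | finite_set a].

Definition Inf : set (set nat) := [set a | infinite_set a].

Definition almost_subset (a b : set nat) : Prop := finite_set (a `\` b).

Definition pseudointersection (F : set (set nat)) (a : set nat) : Prop :=
  Inf a /\ forall b, F b -> almost_subset a b.

Definition centered (F : set (set nat)) : Prop :=
  F `<=` Inf /\
  forall G : set (set nat), G `<=` F -> finite_set G ->
    Inf (\bigcap_(b in G) b).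

Definition centered_nopseudo (F : set (set nat)) : Prop :=
  centered F /\ ~ exists a, pseudointersection F a.

Lemma min_card (T : Type) (C : set (set T)) :
  C !=set0 -> exists2 A, C A & forall B, C B -> A #<= B.
Proof.
move=> [F0 CF0].
pose P (M : set (set T -> T)) :=
  (forall f A, M f -> C A -> A (f A)) /\
  (forall f g A, M f -> M g -> C A -> f A = g A -> f = g).
have [|M [[M1 M2] Mmax]] := @Zorn_bigcup _ P.
  move=> F FP tot; split.
    by move=> f A [N FN Nf] CA; have [h _] := FP _ FN; exact: h Nf CA.
  move=> f g A [N FN Nf] [N' FN' N'g] CA fg.
  have [NN'|N'N] := tot _ _ FN FN'.
    by have [_ h] := FP _ FN'; exact: (h f g A (NN' _ Nf) N'g CA fg).
  by have [_ h] := FP _ FN; exact: (h f g A Nf (N'N _ N'g) CA fg).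
have [A CA AM] : exists2 A, C A & forall x, A x -> exists2 f, M f & f A = x.
  apply: contrapT => nA.
  have /choice[f fP] : forall A, exists x,
      C A -> A x /\ ~ (exists2 f, M f & f A = x).
    move=> A; have [CA|nCA] := pselect (C A); last first.
      have [[x _]|n0] := pselect (F0 !=set0); first by exists x.
      exfalso; apply: nA; exists F0 => // x F0x.
      by case: n0; exists x.
    apply: contrapT => nx; apply: nA; exists A => // x Ax.
    by apply: contrapT => nf; apply: nx; exists x.
  apply: (Mmax (M `|` [set f])).
    split; first by move=> g; left.
    move=> /(_ f (or_intror erefl)) Mf.
    by have [_] := fP _ CF0; apply; exists f.
  split.
    by move=> g A [Mg|->] CA; [exact: (M1 _ _ Mg CA)|have [] := fP _ CA].
  move=> g h A [Mg|->] [Mh|->] CA gh //; first exact: (M2 _ _ A).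
    by have [_] := fP _ CA; case; exists g.
  by have [_] := fP _ CA; case; exists h.
exists A => // B CB.
have /choice[s sP] : forall x : A, exists y,
    exists2 f, M f & f A = set_val x /\ f B = y.
  by move=> x; have [f Mf fA] := AM _ (set_valP x); exists (f B), f.
have sB x : B (s x).
  by have [f Mf [_ <-]] := sP x; exact: (M1 _ _ Mf CB).
pose s' (x : A) : B := SigSub (mem_set (sB x)).
apply/card_leP/injfunPex; exists s' => // x y _ _ /(congr1 set_val) /= sxy.
have [f Mf [fA fB]] := sP x; have [g Mg [gA gB]] := sP y.
have fg : f = g by apply: (M2 _ _ B) => //; rewrite fB gB.
by apply: val_inj; rewrite /= -[LHS]fA -[RHS]gA fg.
Qed.

(* The increasing enumeration of a set, indexed from 0; its value on a finite
   set is irrelevant. *)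
Definition incr_enum (a : set nat) : nat -> nat :=
  get [set e : nat -> nat | {homo e : m n / m < n} /\ range e = a].

Lemma incr_enumP (a : set nat) : Inf a ->
  {homo incr_enum a : m n / m < n} /\ range (incr_enum a) = a.
Proof.
move=> ainf.
suff : exists e : nat -> nat, {homo e : m n / m < n} /\ range e = a.
  by move/getPex.
have unb k : exists m, `[< a m /\ k <= m >].
  apply: contrapT => nk; apply: ainf.
  apply: (@sub_finite_set _ _ `I_k); last exact: finite_II.
  move=> m am /=; rewrite ltnNge; apply/negP => km; apply: nk.
  by exists m; apply/asboolP.
pose nxt k := ex_minn (unb k).
have nxtP k : [/\ a (nxt k), k <= nxt k & forall m, a m -> k <= m -> nxt k <= m].
  rewrite /nxt; case: ex_minnP => m /asboolP[am km] mmin; split=> // j aj kj.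
  by apply: mmin; apply/asboolP.
pose e := fix e n := if n is n'.+1 then nxt (e n').+1 else nxt 0.
have eS n : e n < e n.+1 by have [] := nxtP (e n).+1.
have einc : {homo e : m n / m < n} by apply: homo_ltn => //; exact: ltn_trans.
exists e; split=> //; apply/seteqP; split=> [_ [n _ <-]|m am].
  by case: n => [|n]; [have [] := nxtP 0 | have [] := nxtP (e n).+1].
apply: contrapT => nm.
have em n : e n < m.
  elim: n => [|n IHn]; rewrite ltn_neqAle; apply/andP; split.
  - by apply/eqP => em; apply: nm; exists 0.
  - by have [_ _] := nxtP 0; apply.
  - by apply/eqP => em; apply: nm; exists n.+1.
  - by have [_ _] := nxtP (e n).+1; apply.
have ge_e n : n <= e n by elim: n => // n IHn; exact: leq_ltn_trans (eS n).
by have := em m; rewrite ltnNge ge_e.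
Qed.

Lemma centered_nopseudo_ex : centered_nopseudo !=set0.
Proof.
have [U [UU ooU]] := @ultraFilterLemma nat \oo _.
have Uinf b : U b -> Inf b.
  move=> Ub fb; suff : U set0 by exact: filter_not_empty.
  have [n bn] : exists n, forall m, b m -> m < n.
    have [s ->] := (finite_seqP _).1 fb.
    exists (\max_(i <- s) i).+1 => m /= ms.
    by rewrite ltnS; exact: (leq_bigmax_seq m ms).
  have : U (~` b).
    by apply: ooU; exists n => // m /= nm /bn; rewrite ltnNge nm.
  by move=> UNb; rewrite -(setICr b); exact: filterI.
exists [set b | U b]; split.
  split=> [b|G GU /finite_fsetP[D GD]]; first exact: Uinf.
  apply: Uinf; rewrite GD; apply: filter_bigI => i iD.
  by apply: GU; rewrite GD.
move=> [a [ainf aU]].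
have [einc ea] := incr_enumP ainf.
set e := incr_enum a in einc ea.
have einj : injective e.
  by move=> m n; have [/einc|/einc|//] := ltngtP m n => + emn; rewrite emn ltnn.
pose ev := [set e n.*2 | n in setT]; pose od := [set e n.*2.+1 | n in setT].
have infim (h : nat -> nat) : injective h -> infinite_set [set e (h n) | n in setT].
  move=> hi; apply/infiniteP; apply/card_leP/injfunPex.
  exists (fun n : [set: nat] =>
    SigSub (mem_set (imageP (fun n => e (h n)) (set_valP n)))) => //.
  move=> x y _ _ /(congr1 val) /= /einj /hi xy; exact: val_inj.
have [Uev|Uev] := in_ultra_setVsetC ev UU.
  apply: (@infim (fun n => n.*2.+1)); first by move=> m n [/double_inj].
  apply: sub_finite_set (aU _ Uev) => _ [n _ <-]; split.
    by rewrite -ea; exists n.*2.+1.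
  by move=> [m _ /einj /(congr1 odd)]; rewrite /= !odd_double.
apply: (@infim double); first exact: double_inj.
apply: sub_finite_set (aU _ Uev) => _ [n _ <-]; split.
  by rewrite -ea; exists n.*2.
by apply; exists n.
Qed.

(* The cardinal p is represented by a set having that cardinality; any two
   such sets are equipotent. *)
Definition has_card_pfrak (F : set (set nat)) : Prop :=
  centered_nopseudo F /\ forall G, centered_nopseudo G -> F #<= G.

Lemma has_card_pfrak_ex : exists F, has_card_pfrak F.
Proof. by have [F ? ?] := min_card centered_nopseudo_ex; exists F. Qed.

Definition pfrak : set (set nat) := sval (cid has_card_pfrak_ex).

Lemma pfrakP : has_card_pfrak pfrak.
Proof. exact: svalP. Qed.

(* K is any set of cardinality kappa. *)
Definition generalized_tower (T : Type) (K : set T) (X : set (set nat)) : Prop :=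
  [/\ X `<=` Inf, K #<= X &
    forall a, Inf a -> exists b S, [/\ Inf b, S `<=` X, card_lt S K &
      forall x, (X `\` S) x ->
        Fin (x `&` \bigcup_(n in b)
          [set m | incr_enum a n <= m < incr_enum a n.+1])]].

Definition char_fun (a : set nat) : cantor_space := fun n => `[< a n >].

Definition cantor_powerset : Type := initial_topology char_fun.
HB.instance Definition _ := Topological.on cantor_powerset.

Definition michael_line : Type := set nat.

Definition michael_nbhs (x : michael_line) : set_system michael_line :=
  if `[< Fin x >] then nbhs (x : cantor_powerset) else principal_filter x.

HB.instance Definition _ := Choice.copy michael_line (set nat).
HB.instance Definition _ := hasNbhs.Build michael_line michael_nbhs.

Lemma michael_nbhs_filter (x : michael_line) : ProperFilter (nbhs x).
Proof.
rewrite /nbhs /= /michael_nbhs; case: asboolP => _.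
  exact: (@nbhs_pfilter cantor_powerset).
exact: principal_filter_proper.
Qed.

Lemma michael_nbhs_singleton (x : michael_line) (A : set michael_line) :
  nbhs x A -> A x.
Proof.
rewrite /nbhs /= /michael_nbhs; case: asboolP => _.
  exact: (@nbhs_singleton cantor_powerset).
by move/principal_filterP.
Qed.

Lemma michael_nbhs_nbhs (x : michael_line) (A : set michael_line) :
  nbhs x A -> nbhs x (nbhs^~ A).
Proof.
rewrite /nbhs /= {1 2}/michael_nbhs; case: asboolP => xF.
  move=> /(@nbhs_interior cantor_powerset); apply: filterS => y yA.
  rewrite /michael_nbhs; case: asboolP => // _.
  by apply/principal_filterP; exact: (@nbhs_singleton cantor_powerset).
move=> /principal_filterP Ax; apply/principal_filterP.
by rewrite /michael_nbhs; case: asboolP => // _; apply/principal_filterP.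
Qed.

HB.instance Definition _ := Nbhs_isNbhsTopological.Build michael_line
  michael_nbhs_filter michael_nbhs_singleton michael_nbhs_nbhs.

(* Coerced to a type, it carries the topology induced by the Michael line. *)
Definition tower_set (X : set (set nat)) : set michael_line := X `|` Fin.

Section Covers.
Context {T : topologicalType}.
Implicit Types (U V : set (set T)) (A B : set (set (set T))).

Definition is_cover U : Prop :=
  (forall O, U O -> O <> setT) /\ \bigcup_(O in U) O = setT.

Definition open_cover U : Prop := is_cover U /\ U `<=` open.

Definition omega_cover U : Prop :=
  open_cover U /\
  forall E : set T, finite_set E -> exists2 O, U O & E `<=` O.

Definition gamma_cover U : Prop :=
  [/\ open_cover U, infinite_set U &
    forall x, finite_set [set O | U O /\ ~ O x]].

Definition Omega_ctbl : set (set (set T)) :=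
  [set U | omega_cover U /\ countable U].

Definition Gamma : set (set (set T)) := [set U | gamma_cover U].

Definition binom_property A B : Prop :=
  forall U, A U -> exists2 V, V `<=` U & B V.

End Covers.

(* Main.v *)
(* A family is "small" when it has fewer than p members; small families are
   closed under binary unions, and small point-families of a countable cover can
   be handled by one pseudointersection.

   Given a small S, a pseudointersection makes the cover a gamma-cover on
   S together with Fin, and finiteness of each P([0,k)) then yields
   intervals I_n moving to infinity and members O_n of the cover such that every
   point missing I_n lies in O_n.  The tower property thins this sequence so that
   only a small set T of points fails to be eventually in O_n.  Iterating with
   S_(i+1) = S_i u T_i gives sequences (O^i_n)_n, and each point is eventually in
   O^i_n for all large i, since it lies in T_i \ S_i for at most one i.

   Choose d so that, for i <= j, [d_j, d_(j+1)) contains the interval of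
   O^i_(d_j), and let b, S' be given by the tower property for d.  Points
   outside S' are good for all but finitely many of the pairs i <= j, j in b.
   The small family of sets {(i,j) : y in O^i_(d_j)}, y in S' or Fin, is centered
   on these pairs, so a pseudointersection of it gives the gamma-cover.  One
   never has to absorb all the S_i at once, so regularity of p is not needed. *)
Require Import Defs.
From mathcomp Require Import all_boot.
From mathcomp Require Import all_classical.
From mathcomp Require Import topology cantor.

Set Implicit Arguments.
Unset Strict Implicit.
Unset Printing Implicit Defensive.

Local Open Scope classical_set_scope.
Local Open Scope card_scope.

(** * Families with fewer than p members *)

(* Cardinals being comparable, this says that [S] has cardinality below p. *)
Definition small (S : set (set nat)) : Prop := ~ (pfrak #<= S).

Lemma small_card_le (S T : set (set nat)) : S #<= T -> small T -> small S.
Proof. by move=> ST + pS; apply; exact: card_le_trans pS ST. Qed.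

Lemma small_pseudointersection (F : set (set nat)) :
  small F -> centered F -> exists a, pseudointersection F a.
Proof.
move=> sF cF; apply: contrapT => nF; apply: sF.
by have [_] := pfrakP; apply.
Qed.

(** [min_card] picks a member of least cardinality from the pair of the two sets. *)
Lemma card_le_total (T : Type) (A B : set T) : A #<= B \/ B #<= A.
Proof.
have [|C [->|->] CP] := @min_card T [set A; B]; first by exists A; left.
- by left; apply: CP; right.
- by right; apply: CP; left.
Qed.

Lemma sub_image_finite (T U : Type) (G : T -> U) (S : set T) (H : set U) :
  H `<=` G @` S -> finite_set H ->
  exists K, [/\ K `<=` S, finite_set K & H = G @` K].
Proof.
move=> HG Hfin.
have /choice[t tP] : forall h : H, exists t, S t /\ G t = set_val h.
  by move=> h; have [t St Gt] := HG _ (set_valP h); exists t.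
exists (range t); split.
- by move=> _ [h _ <-]; have [] := tP h.
- apply: finite_image; apply: card_le_finite Hfin.
  by have /card_eqPle[] := card_setT H.
- apply/seteqP; split=> [h Hh|_ [_ [h _ <-] <-]].
    pose h' : H := SigSub (mem_set Hh).
    by exists (t h'); [exists h'|have [] := tP h'].
  by have [_ ->] := tP h; exact: set_valP.
Qed.

Lemma sub_Inf (a b : set nat) : a `<=` b -> Inf a -> Inf b.
Proof. by move=> ab; apply: contra_not; exact: sub_finite_set. Qed.

Lemma centered_image (T : Type) (G : T -> set nat) (S : set T) :
  (forall E, E `<=` S -> finite_set E -> Inf (\bigcap_(s in E) G s)) ->
  centered (G @` S).
Proof.
move=> Gcap; split=> [_ [s Ss <-]|H HG Hfin].
  by rewrite -(bigcap_set1 G s); apply: Gcap => // _ ->.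
have [K [KS Kfin ->]] := sub_image_finite HG Hfin.
by rewrite bigcap_image; exact: Gcap.
Qed.

(* Passing to the intersections over the fibers of [r] turns [pfrak] into a
   centered family without pseudointersection that is indexed by [T]. *)
Lemma pfrak_le_finite_to_one (T : set (set nat)) (r : set nat -> set nat) :
  (forall x, pfrak x -> T (r x)) ->
  (forall t, finite_set (pfrak `&` r @^-1` [set t])) -> pfrak #<= T.
Proof.
move=> rT rfin; have [[[pinf pcap] pnp] pmin] := pfrakP.
pose G t := \bigcap_(x in pfrak `&` r @^-1` [set t]) x.
suff : pfrak #<= G @` T by move/card_le_trans; apply; exact: card_image_le.
apply: pmin; split.
  apply: centered_image => E ET Efin.
  have /pcap : \bigcup_(t in E) (pfrak `&` r @^-1` [set t]) `<=` pfrak.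
    by move=> x [h _ []].
  move/(_ (bigcup_finite Efin (fun t _ => rfin t))); apply: sub_Inf.
  by move=> n nE t Et x xt; apply: nE; exists t.
move=> [a [ainf aG]]; apply: pnp; exists a; split=> // x px.
apply: sub_finite_set (aG (G (r x)) _); last by exists (r x) => //; exact: rT.
by move=> n [an nx]; split=> // /(_ x); apply: contra_not nx; apply.
Qed.

(** If [S] injects into [T], an injection of [pfrak] into the union becomes an at most two-to-one
    map into [T] once the values in [S] are sent into [T]. *)
Lemma small_setU (S T : set (set nat)) : small S -> small T -> small (S `|` T).
Proof.
wlog ST : S T / S #<= T.
  move=> h sS sT; have [ST|TS] := card_le_total S T; first exact: h.
  by rewrite setUC; exact: h.
move=> _ sT /pcard_leP/injfunPex[e eST einj]; apply: sT.
move/pcard_leP/injfunPex: ST => [i iT iinj].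
apply: (@pfrak_le_finite_to_one _
  (fun x => if `[< S (e x) >] then i (e x) else e x)).
  by move=> x px; case: asboolP => [/iT//|nS]; have [] := eST x px.
move=> t; pose P b := pfrak `&` [set x | `[< S (e x) >] = b /\
  (if b then i (e x) else e x) = t].
have Pfin b : finite_set (P b).
  have [[x [px [Sx xt]]]|nP] := pselect (P b !=set0); last first.
    by rewrite (_ : P b = set0) //; apply/seteqP; split=> // x Px; case: nP; exists x.
  apply: (@sub_finite_set _ _ [set x]) => // y [py [Sy yt]] /=.
  apply: einj; rewrite ?inE //.
  case: b Sx Sy xt yt => Sx Sy xt yt; last by rewrite yt xt.
  by apply: iinj; rewrite ?inE ?xt ?yt //; apply/asboolP.
apply: (@sub_finite_set _ _ (P true `|` P false)); last by rewrite finite_setU.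
by move=> x [px /=]; case: (boolP `[< _ >]) => Sx xt; [left|right]; split=> //;
  split=> //; apply/negbTE.
Qed.

Lemma Inf_unbounded (a : set nat) (n : nat) : Inf a -> exists2 m, a m & n <= m.
Proof.
move=> ainf; apply: contrapT => h; apply: ainf.
apply: (@sub_finite_set _ _ `I_n) => // m am /=.
by rewrite ltnNge; apply/negP => nm; apply: h; exists m.
Qed.

Lemma finite_set_near (B : set nat) : finite_set B -> \forall n \near \oo, ~ B n.
Proof.
move=> /finite_seqP[s ->]; exists (\max_(i <- s) i).+1 => // n /= sn.
move=> ns; move: sn; apply/negP; rewrite -leqNgt.
exact: (leq_bigmax_seq n ns).
Qed.

Lemma Inf_range (e : nat -> nat) : (forall n, n <= e n) -> Inf (range e).
Proof.
move=> ne /finite_set_near[n _ /(_ (e n) (ne n))]; apply; by exists n.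
Qed.

Lemma finite_set_inj (T U : Type) (A : set T) (e : T -> U) :
  {in A &, injective e} -> finite_set (e @` A) -> finite_set A.
Proof. by move=> /inj_card_eq/card_eqPle[_]; exact: card_le_finite. Qed.

(** Diagonal argument: with [pfrak] enumerated by [e], choose [h n >= n] in the finite intersection
    [D n]; the range of [h] would be a pseudointersection of [pfrak]. *)
Lemma small_countable (S : set (set nat)) : countable S -> small S.
Proof.
move=> Sc pS; have [[[pinf pcap] pnp] _] := pfrakP.
have /countable_injP[e einj] : countable pfrak by exact: sub_countable pS Sc.
pose D n := \bigcap_(x in pfrak `&` [set x | e x <= n]) x.
have /choice[h hP] n : exists m, D n m /\ n <= m.
  suff /(@Inf_unbounded _ n)[m Dm nm] : Inf (D n) by exists m.
  apply: pcap => [x []//|]; apply: (@finite_set_inj _ _ _ e).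
    by move=> x y /set_mem[px _] /set_mem[py _]; apply: einj; rewrite inE.
  by apply: (@sub_finite_set _ _ `I_n.+1) => // _ [x [_ xn] <-].
apply: pnp; exists (range h); split; first by apply: Inf_range => n; have [] := hP n.
move=> x px; apply: (@sub_finite_set _ _ (h @` `I_(e x))); last exact: finite_image.
move=> _ [[n _ <-] nx]; exists n => //=; rewrite ltnNge; apply/negP => exn.
by apply: nx; have [+ _] := hP n; apply.
Qed.

(** * Sequences eventually inside every set of a small family *)

Lemma near_forall_finite (T : choiceType) (E : set T) (P : T -> nat -> Prop) :
  finite_set E -> (forall s, E s -> \forall n \near \oo, P s n) ->
  \forall n \near \oo, forall s, E s -> P s n.
Proof.
by move=> /finite_fsetP[D ->] DP; apply: filter_bigI => s sD; exact: DP.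
Qed.

Lemma near_injective_finite (I : Type) (c : nat -> I) (B : set I) :
  injective c -> finite_set B -> \forall n \near \oo, ~ B (c n).
Proof.
move=> cinj Bfin; apply: finite_set_near (c @^-1` B) _.
by apply: finite_preimage => // x y _ _; exact: cinj.
Qed.

(** Carries pseudointersections from [nat] to a countable index set [C] through an injection [e],
    and lists the result without repetition. *)
Lemma small_pseudo_sequence (I : Type) (C : set I) (S : set (set nat))
    (A : set nat -> set I) :
  countable C -> small S -> S !=set0 ->
  (forall E, E `<=` S -> finite_set E ->
    infinite_set (C `&` \bigcap_(s in E) A s)) ->
  exists c : nat -> I, [/\ injective c, forall n, C (c n) &
    forall s, S s -> \forall n \near \oo, A s (c n)].
Proof.
move=> /countable_injP[e einj] sS [s0 Ss0] CA.
pose G s := e @` (C `&` A s).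
have [||a [ainf aG]] := small_pseudointersection (F := G @` S).
- by apply: small_card_le sS; exact: card_image_le.
- apply: centered_image => E ES Efin.
  apply: (@sub_Inf (e @` (C `&` \bigcap_(s in E) A s))).
    by move=> _ [i [Ci iE] <-] s Es; exists i => //; split=> //; exact: iE.
  apply: contra_not (CA E ES Efin); apply: finite_set_inj.
  by move=> x y /set_mem[xC _] /set_mem[yC _]; apply: einj; rewrite inE.
(* This uses that [S] is nonempty: [a] is almost contained in [G s0], hence in the image of [C]. *)
have a'inf : Inf (a `&` e @` C).
  apply: contra_not ainf => a'fin.
  apply: (@sub_finite_set _ _ ((a `&` e @` C) `|` (a `\` G s0))); last first.
    by rewrite finite_setU; split=> //; apply: aG; exists s0.
  move=> n an; have [[i [Ci _] ein]|nG] := pselect (G s0 n); last by right.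
  by left; split=> //; exists i.
have [f_lt f_range] := incr_enumP a'inf; set f := incr_enum _ in f_lt f_range.
have finj : injective f.
  by move=> m n; apply: contra_eq; case: ltngtP => // /f_lt; case: ltngtP.
have /choice[c cP] n : exists i, C i /\ e i = f n.
  have [_ [i Ci <-]] : (a `&` e @` C) (f n) by rewrite -f_range; exists n.
  by exists i.
exists c; split=> [m n /(congr1 e)||s Ss].
- by have [_ ->] := cP m; have [_ ->] := cP n; exact: finj.
- by move=> n; have [] := cP n.
have aGs : almost_subset a (G s) by apply: aG; exists s.
apply: filterS (near_injective_finite finj aGs) => n nfin.
have [Cn en] := cP n.
have an : a (f n) by have [] : (a `&` e @` C) (f n) by rewrite -f_range; exists n.
have [i [Ci Ai] ein] : G s (f n) by apply: contrapT => nG; apply: nfin.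
by rewrite (_ : c n = i) //; apply: einj; rewrite ?inE // en ein.
Qed.

(** * Neighborhoods of finite sets in the Michael line *)

Lemma open_Fin_cylinder (X : set (set nat)) (O : set (tower_set X))
    (y : tower_set X) : open O -> O y -> Fin (\val y) ->
  \forall N \near \oo, forall z : tower_set X,
    (forall m, m < N -> (\val z) m <-> (\val y) m) -> O z.
Proof.
move=> [V oV <-] /= Vy yF.
have : nbhs (set_val y : cantor_powerset) V.
  have := open_nbhs_nbhs (conj oV Vy).
  by rewrite {1}/nbhs /= /michael_nbhs; case: asboolP => // nF; case: nF.
rewrite nbhsE => -[_ [[W oW <-] /= Wy WV]].
(* If no [N] worked, there would be points [z N] outside [V] agreeing with [y] below [N]; they
   converge pointwise to [y], so some of them lie in [V]. *)
apply: contrapT => nN.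
have /choice[z zP] N : exists z : tower_set X,
    (forall m, m < N -> (\val z) m <-> (\val y) m) /\ ~ V (set_val z).
  apply: contrapT => /forallNP h; apply: nN; exists N => // M /= NM z zy.
  apply: contrapT => nV; apply: (h z); split=> // m mN.
  by apply: zy; exact: leq_trans NM.
have zy : (fun n => char_fun (set_val (z n))) @ \oo --> char_fun (set_val y).
  apply/(@pointwise_cvgP nat bool) => m.
  apply: cvg_near_cst; exists m.+1 => // n /= mn.
  by apply/asbool_equiv_eq; have [+ _] := zP n; apply.
have [N _ /(_ N (leqnn N))/WV] := zy _ (open_nbhs_nbhs (conj oW Wy)).
by have [_] := zP N.
Qed.

(** * Increasing sequences and their enumerations *)

Lemma near_reindex (P : nat -> Prop) (f : nat -> nat) :
  (forall n, n <= f n) -> (\forall n \near \oo, P n) ->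
  \forall n \near \oo, P (f n).
Proof.
move=> nf [N _ NP]; exists N => // n /= Nn; apply: NP => /=.
exact: leq_trans (nf n).
Qed.

Lemma near_exists_gt (P : nat -> Prop) (k : nat) :
  (\forall n \near \oo, P n) -> exists2 n, k < n & P n.
Proof.
move=> [N _ NP]; exists (maxn N k.+1); first exact: leq_maxr.
by apply: NP; exact: leq_maxl.
Qed.

Lemma incr_ge_id (e : nat -> nat) : {homo e : m n / m < n} -> forall n, n <= e n.
Proof. by move=> elt; elim=> // n IHn; exact: leq_ltn_trans IHn (elt _ _ _). Qed.

Lemma incr_range_le (f g : nat -> nat) :
  {homo f : m n / m < n} -> {homo g : m n / m < n} -> range f `<=` range g ->
  forall n, g n <= f n.
Proof.
move=> f_lt g_lt fg n; have g_mono := leq_mono g_lt.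
suff [k -> nk] : exists2 k, f n = g k & n <= k by rewrite g_mono.
elim: n => [|n [k fk nk]]; first by have [k _ <-] := fg (f 0) (imageP f I); exists k.
have [l _ gl] := fg (f n.+1) (imageP f I); exists l => //.
apply: leq_ltn_trans nk _.
by rewrite -(leqW_mono g_mono) gl -fk; exact: f_lt.
Qed.

(** Lets the tower property, stated for sets, be applied to an increasing sequence of endpoints. *)
Lemma incr_enum_range (e : nat -> nat) :
  {homo e : m n / m < n} -> incr_enum (range e) = e.
Proof.
move=> elt.
have [f_lt fe] := incr_enumP (Inf_range (incr_ge_id elt)).
by apply/funext => n; apply/eqP; rewrite eqn_leq !incr_range_le // fe.
Qed.

(** * Omega-covers and intervals *)

Lemma omega_cover_infinite (T : topologicalType) (U : set (set T)) (E : set T) :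
  omega_cover U -> finite_set E -> infinite_set (U `&` [set O | E `<=` O]).
Proof.
move=> [[[Uproper _] _] Uomega] Efin Dfin.
have ex O : U O -> exists y, ~ O y.
  move=> UO; apply: contrapT => nO; apply: (Uproper O UO).
  by apply/seteqP; split=> // y _; apply: contrapT => nOy; apply: nO; exists y.
(* The cover has a member, which provides a default point [y0] for the choice at sets outside
   [U]. *)
have [O0 UO0 _] := Uomega _ (finite_set0 T).
have [y0 _] := ex O0 UO0.
have /choice[y yP] O : exists y, U O -> ~ O y.
  by have [/ex[y Oy]|nU] := pselect (U O); [exists y|exists y0].
(* Enlarge [E] by one missed point for each of the finitely many members containing [E]; a member
   containing the enlarged set would contain the point chosen outside it. *)
have [|O UO EO] := Uomega (E `|` y @` (U `&` [set O | E `<=` O])).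
  by rewrite finite_setU; split=> //; exact: finite_image.
have OE : E `<=` O by move=> x Ex; apply: EO; left.
by apply: (yP O UO); apply: EO; right; exists O.
Qed.

Lemma finite_subsets_II (k : nat) : finite_set [set s : set nat | s `<=` `I_k].
Proof.
apply: (@sub_finite_set _ _
  (range (fun f : {set 'I_k} => [set m | exists2 i, i \in f & m = i :> nat]))).
  move=> s sk; exists [set i : 'I_k | `[< s i >]]%SET => //.
  apply/seteqP; split=> [_ [i + ->]|m sm]; first by rewrite inE => /asboolP.
  by exists (Ordinal (sk m sm)) => //; rewrite inE; apply/asboolP.
apply: finite_image; exact: finite_finset.
Qed.

Lemma countable_Fin : countable Fin.
Proof.
apply: (@sub_countable _ _ _ (range (fun s : seq nat => [set` s]))).
  by apply: subset_card_le => a /finite_seqP[s ->]; exists s.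
exact: sub_countable (card_image_le _ _) (countableP _).
Qed.

(** There are finitely many subsets of [0,k), so one member contains them all, and by openness it
    contains every point agreeing with one of them below some [k']. A point missing [k,k') agrees
    below [k'] with its trace on [0,k). *)
Lemma cover_intervals (X : set (set nat)) (c : nat -> set (tower_set X)) :
  (forall n, open (c n)) ->
  (forall y, Fin (\val y) -> \forall n \near \oo, c n y) ->
  exists a v : nat -> nat, [/\ {homo a : m n / m < n}, forall n, n <= v n &
    forall n y, (forall m, a n <= m < a n.+1 -> ~ (\val y) m) -> c (v n) y].
Proof.
move=> c_open c_Fin.
have /choice[nxt nxtP] (p : nat * nat) : exists q : nat * nat,
    [/\ p.1 < q.1, p.2 < q.2 & forall y : tower_set X,
      (forall m, p.1 <= m < q.1 -> ~ (\val y) m) -> c q.2 y].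
  case: p => k l /=.
  have subk s : s `<=` `I_k -> Fin s by move=> /sub_finite_set; apply; exact: finite_II.
  have [l' ll' cl'] : exists2 l', l < l' &
      forall s, s `<=` `I_k -> forall y : tower_set X, \val y = s -> c l' y.
    apply: near_exists_gt; apply: near_forall_finite (finite_subsets_II k) _ => s sk.
    have Ts : tower_set X s by right; exact: subk.
    apply: filterS (c_Fin (SigSub (mem_set Ts)) (subk _ sk)) => n cn y ys.
    by rewrite (_ : y = SigSub (mem_set Ts)) //; exact: val_inj.
  have [k' kk' ck'] : exists2 k', k < k' & forall s, s `<=` `I_k ->
      forall z : tower_set X, (forall m, m < k' -> (\val z) m <-> s m) -> c l' z.
    apply: near_exists_gt; apply: near_forall_finite (finite_subsets_II k) _ => s sk.
    have Ts : tower_set X s by right; exact: subk.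
    apply: (@open_Fin_cylinder _ _ (SigSub (mem_set Ts))) => //=; last exact: subk.
    exact: cl' sk _ _.
  exists (k', l'); split=> //= y yk.
  apply: (ck' (\val y `&` `I_k)) => [m []//|m mk']; split=> [ym|[]//].
  split=> //=; rewrite ltnNge; apply/negP => km; apply: (yk m) => //.
  by rewrite km mk'.
(* A state records the last endpoint and the last index used. The member for the interval starting
   at [(p n).1] is found together with its right end, hence the index [(p n.+1).2]. *)
pose p n := iter n nxt (0, 0).
exists (fun n => (p n).1), (fun n => (p n.+1).2); split.
- by apply: homo_ltn => [|n]; [exact: ltn_trans|have [] := nxtP (p n)].
- elim=> // n IHn; apply: leq_ltn_trans IHn _.
  by have [_ + _] := nxtP (p n.+1).
- by move=> n y; have [_ _] := nxtP (p n); apply.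
Qed.

(** * Thinning by the tower property, and the iteration *)

Lemma tower_step (X : set (set nat)) (U : set (set (tower_set X)))
    (S : set (set nat)) :
  generalized_tower pfrak X -> Omega_ctbl U -> small S ->
  exists (lo hi : nat -> nat) (O : nat -> set (tower_set X)) (T : set (set nat)),
    [/\ forall n, n <= lo n /\ U (O n), small T,
      forall n y, (forall m, lo n <= m < hi n -> ~ (\val y) m) -> O n y &
      forall y, S (\val y) \/ ~ T (\val y) -> \forall n \near \oo, O n y].
Proof.
move=> [XInf _ Xtower] [Uomega Uctbl] sS.
(* If [s] is not a point of the space, [A s] is the full set; this accommodates arbitrary [S]. *)
pose A (s : set nat) := [set O : set (tower_set X) | forall y, \val y = s -> O y].
have [|||c [_ cU cA]] := @small_pseudo_sequence _ U (S `|` Fin) A Uctbl.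
- by apply: small_setU => //; apply: small_countable; exact: countable_Fin.
- by exists set0; right; exact: finite_set0.
- move=> E _ Efin; have E'fin : finite_set (@set_val _ (tower_set X) @^-1` E).
    by apply: finite_preimage Efin => x y _ _; exact: val_inj.
  apply: contra_not (omega_cover_infinite Uomega E'fin); apply: sub_finite_set.
  move=> O [UO EO]; split=> // s Es y ys.
  by apply: EO; rewrite /= -[set_val y]/(\val y) ys.
have [[_ Uopen] _] := Uomega.
have [|y yF|a [v [a_lt v_ge av]]] := @cover_intervals X c.
- by move=> n; apply: Uopen; exact: cU.
- by apply: filterS (cA (\val y) (or_intror yF)) => n; apply.
(* Among the intervals with endpoints [a], keep those numbered by [b]: points of [X] outside [T]
   meet their union in a finite set. *)
have [b [T [binf TX [_ sT] bT]]] := Xtower _ (Inf_range (incr_ge_id a_lt)).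
rewrite incr_enum_range // in bT.
have [f_lt fb] := incr_enumP binf; set f := incr_enum b in f_lt fb.
have f_ge := incr_ge_id f_lt.
exists (a \o f), (fun n => a (f n).+1), (fun n => c (v (f n))), T; split=> //.
- by move=> n; split=> //; exact: leq_trans (f_ge n) (incr_ge_id a_lt _).
- by move=> n y; exact: av.
move=> y yST.
have [Sy|nSy] := pselect ((S `|` Fin) (\val y)).
  apply: (@near_reindex (fun n => c n y) (v \o f)) => [n|].
    exact: leq_trans (f_ge n) (v_ge _).
  by apply: filterS (cA _ Sy) => n; apply.
have Xy : (X `\` T) (\val y).
  split; first by have [|yF] := set_valP y => //; case: nSy; right.
  by case: yST => // Sy; case: nSy; left.
have [N _ NP] := finite_set_near (bT _ Xy).
exists N => // n /= Nn; apply: av => m amn ym.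
apply: (NP m); last by split=> //; exists (f n) => //; rewrite -fb; exists n.
case/andP: amn => + _; apply: leq_trans; apply: leq_trans Nn _.
exact: leq_trans (f_ge n) (incr_ge_id a_lt _).
Qed.

Theorem theorem2p1 (X : set (set nat)) (hX : generalized_tower pfrak X) :
  binom_property (T := tower_set X) Omega_ctbl Gamma.
Proof.
move=> U hU; have [XInf _ Xtower] := hX.
have [[[[Uproper _] Uopen] _] _] := hU.
(* [F] fixes the data of [tower_step]: [R.1.1.1] and [R.1.1.2] are the interval ends, [R.1.2] the
   members, [R.2] the exceptional family. Families that are not small get dummy values. *)
have /choice[F FP] (S : set (set nat)) :
    exists R : (nat -> nat) * (nat -> nat) * (nat -> set (tower_set X)) *
      set (set nat), small S ->
    [/\ forall n, n <= R.1.1.1 n /\ U (R.1.2 n), small R.2,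
      forall n y, (forall m, R.1.1.1 n <= m < R.1.1.2 n -> ~ (\val y) m) ->
        R.1.2 n y &
      forall y, S (\val y) \/ ~ R.2 (\val y) -> \forall n \near \oo, R.1.2 n y].
  have [sS|nS] := pselect (small S).
    by have [lo [hi [O [T RP]]]] := tower_step hX hU sS; exists (lo, hi, O, T).
  by exists ((fun=> 0), (fun=> 0), (fun=> set0), set0).
pose S i := iter i (fun S => S `|` (F S).2) set0.
have sS i : small (S i).
  elim: i => [|i IHi]; first by apply: small_countable; exact: countable0.
  by apply: small_setU => //; have [] := FP _ IHi.
pose lo i := (F (S i)).1.1.1; pose hi i := (F (S i)).1.1.2.
pose O i := (F (S i)).1.2; pose T i := (F (S i)).2.
have S_le i j : i <= j -> S i `<=` S j.
  by move=> /subnK <-; elim: (j - i) => // k IHk x /IHk; left.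
(* A point of some [S i] stays in all later ones and is good there; a point of none avoids every
   [T k], since [T k] is absorbed into [S k.+1]. *)
have Onear (y : tower_set X) :
    \forall i \near \oo, \forall j \near \oo, O i j y.
  have [[i Siy]|nS] := pselect (exists i, S i (\val y)).
    exists i => // k /= ik; have [_ _ _] := FP _ (sS k).
    by apply; left; exact: S_le ik _ Siy.
  exists 0 => // k _; have [_ _ _] := FP _ (sS k); apply; right.
  by move=> Tky; apply: nS; exists k.+1; right.
(* Only the finitely many [i <= j] enter the maximum at [d j.+1], whence the restriction to such
   pairs in [C]. *)
pose d := fix d j := if j is j'.+1 then
  maxn (d j').+1 (\max_(i < j'.+1) hi i (d j')) else 0.
have d_lt : {homo d : m n / m < n}.
  by apply: homo_ltn => [|n]; [exact: ltn_trans|exact: leq_maxl].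
have d_hi i j : i <= j -> hi i (d j) <= d j.+1.
  rewrite -ltnS => ij; apply: leq_trans (leq_maxr _ _).
  exact: (leq_bigmax (Ordinal ij)).
have [b [S' [binf _ [_ sS'] bS']]] := Xtower _ (Inf_range (incr_ge_id d_lt)).
rewrite incr_enum_range // in bS'.
pose C := [set p : nat * nat | p.1 <= p.2 /\ b p.2].
pose A (s : set nat) := [set p : nat * nat |
  forall y : tower_set X, \val y = s -> O p.1 (d p.2) y].
have [|||c [cinj cC cA]] :=
  @small_pseudo_sequence _ C (S' `|` Fin) A (countableP C).
- by apply: small_setU => //; apply: small_countable; exact: countable_Fin.
- by exists set0; right; exact: finite_set0.
- move=> E _ Efin.
  (* First fix one [i] good for all of [E]; then every large [j] in [b] gives a pair in the
     intersection, so the second coordinates are unbounded. *)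
  have [i _ Ei] : exists2 i, 0 < i & forall s, E s -> forall y : tower_set X,
      \val y = s -> \forall j \near \oo, O i j y.
    apply: near_exists_gt; apply: near_forall_finite => // s Es.
    have [[y ys]|ns] := pselect (exists y : tower_set X, \val y = s).
      apply: filterS (Onear y) => i yi z zs.
      by rewrite (_ : z = y) //; apply: val_inj; rewrite /= zs.
    by exists 0 => // i _ y ys; case: ns; exists y.
  have [N _ EN] : \forall j \near \oo, forall s, E s -> forall y : tower_set X,
      \val y = s -> O i (d j) y.
    apply: near_forall_finite => // s Es.
    have [[y ys]|ns] := pselect (exists y : tower_set X, \val y = s).
      have := near_reindex (incr_ge_id d_lt) (Ei s Es y ys).
      apply: filterS => j yj z zs.
      by rewrite (_ : z = y) //; apply: val_inj; rewrite /= zs.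
    by exists 0 => // j _ y ys; case: ns; exists y.
  move=> Cfin; have [M _ MP] := finite_set_near (finite_image snd Cfin).
  have [j bj] := Inf_unbounded (maxn M (maxn i N)) binf.
  rewrite !geq_max => /and3P[Mj ij Nj]; apply: (MP j Mj).
  by exists (i, j) => //; split=> // s Es y; exact: EN.
pose W n := O (c n).1 (d (c n).2).
have UW n : U (W n) by have [+ _ _ _] := FP _ (sS (c n).1); move=> /(_ (d (c n).2))[].
have Wnear (y : tower_set X) : \forall n \near \oo, W n y.
  have [S'y|nS'y] := pselect ((S' `|` Fin) (\val y)).
    by apply: filterS (cA _ S'y) => n; apply.
  have Xy : (X `\` S') (\val y).
    split; first by have [|yF] := set_valP y => //; case: nS'y; right.
    by move=> ?; apply: nS'y; left.
  have [M _ MP] := finite_set_near (bS' _ Xy).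
  (* Since [i <= j], only finitely many pairs have [j < M], and the injective [c] eventually leaves
     them. For the others the interval lies in [d_j, d_(j+1)), beyond [M], and so misses [y]. *)
  have Bfin : finite_set (C `&` [set p | p.2 < M]).
    apply: (@sub_finite_set _ _ (`I_M `*` `I_M)); last exact: finite_setX.
    by move=> [i j] [[/= ij _] jM]; split=> //=; exact: leq_ltn_trans jM.
  apply: filterS (near_injective_finite cinj Bfin) => n nB.
  have [ij bj] := cC n.
  have Mj : M <= (c n).2 by rewrite leqNgt; apply/negP => jM; apply: nB.
  have [lo_ge _ disj _] := FP _ (sS (c n).1).
  apply: disj => m /andP[lom mhi] ym.
  have dm : d (c n).2 <= m by apply: leq_trans lom; have [] := lo_ge (d (c n).2).
  apply: (MP m); first exact: leq_trans Mj (leq_trans (incr_ge_id d_lt _) dm).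
  split=> //; exists (c n).2 => //=; rewrite dm /=.
  exact: leq_trans mhi (d_hi _ _ ij).
have Wfin (y : tower_set X) : finite_set [set O | range W O /\ ~ O y].
  have [N _ NP] := Wnear y.
  apply: (@sub_finite_set _ _ (W @` `I_N)); last exact: finite_image.
  move=> _ [[n _ <-] nWy]; exists n => //=.
  by rewrite ltnNge; apply/negP => Nn; apply: nWy; exact: NP.
exists (range W); first by move=> _ [n _ <-].
split=> //; first split; first split.
- by move=> _ [n _ <-]; exact: Uproper.
- apply/seteqP; split=> // y _.
  by have [N _ /(_ N (leqnn N)) WNy] := Wnear y; exists (W N).
- by move=> _ [n _ <-]; exact: Uopen.
(* Distinct pairs may give the same member, so infinity of the range needs an argument: each member
   misses a point that is eventually in [W n], so a finite range would be left by [W n] itself. *)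
move=> Wrange.
have [|N _ /(_ N (leqnn N) (W N))] :=
  @near_forall_finite _ (range W) (fun O n => W n <> O) Wrange; last first.
  by apply=> //; exists N.
move=> O' [n _ <-].
have [y nWy] : exists y, ~ W n y.
  apply: contrapT => nW; apply: (Uproper _ (UW n)); apply/seteqP; split=> // y _.
  by apply: contrapT => nWy; apply: nW; exists y.
by apply: filterS (Wnear y) => m Wmy WW; apply: nWy; rewrite -WW.
Qed.
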